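(* Let $\lambda<0$ and $n\ge4$. Let $a_0$ be a radial initial amplitude, $a_0=a_0(r)\in C^1$, not identically zero. Then the ($C^1$) solution $(\rho,v)$ of the radial compressible Euler–Poisson system $$\partial_\tau(\rho r^{n-1})+\partial_r(\rho v r^{n-1})=0,\qquad \partial_\tau v+v\,\partial_r v-\lambda\tau^{n-4}\partial_r V_{\mathrm p}=0,\qquad \partial_r(r^{n-1}\partial_r V_{\mathrm p})=\rho r^{n-1},$$ $$\rho|_{\tau=0}=|a_0|^2,\qquad v|_{\tau=0}=0,$$ for $\tau\ge 0$, $r\ge0$, breaks down no later than $$T^*=\left(\frac{(n-2)(n-3)}{|\lambda|\sup_{r\ge0}M_0(r)}\right)^{\frac1{n-2}}<\infty .$$
   Context: Here $r=|x|$, $x\in\mathbb{R}^n$, and the ''mean mass'' is $M_0(r)=\frac{1}{r^n}\int_0^r|a_0(s)|^2s^{n-1}\,ds$ (for $r=0$, the limit as $r\to0$). The Poisson equation is understood as $r^{n-1}\partial_rV_{\mathrm p}(\tau,r)=\int_0^r\rho(\tau,s)s^{n-1}\,ds$, and the flux $\rho v r^{n-1}$ vanishes at $r=0$. ''Breaks down no later than $T^*$'' means that the maximal time of existence of the $C^1$ (classical) radial solution is at most $T^*$. *)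

(* Defs.v *)
From HB Require Import structures.
From mathcomp Require Import all_boot all_order all_algebra.
From mathcomp Require Import complex.
From mathcomp Require Import all_classical all_reals all_analysis.

Set Implicit Arguments.
Unset Strict Implicit.
Unset Printing Implicit Defensive.

Import Order.TTheory GRing.Theory Num.Theory.
Import numFieldNormedType.Exports.

Local Open Scope classical_set_scope.
Local Open Scope ring_scope.

(* The domain [0, T) x [0, +oo) has a boundary, so derivatives are taken
   relative to a set D: they are two-sided in the interior of D and one-sided
   at an endpoint of D. *)
Definition diff_quot (R : realType) (f : R -> R) (x : R) : R -> R :=
  fun y => (f y - f x) / (y - x).

Definition derivable_in (R : realType) (D : set R) (f : R -> R) (x : R) :=
  cvg (diff_quot f x @ within D x^').

Definition derive_in (R : realType) (D : set R) (f : R -> R) (x : R) : R :=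
  lim (diff_quot f x @ within D x^').

Definition half_line (R : realType) : set R := [set r | 0 <= r].

Definition time_itv (R : realType) (T : R) : set R := [set t | 0 <= t < T].

Definition C1_half_line (R : realType) (f : R -> R) :=
  (forall r, 0 <= r -> derivable_in (@half_line R) f r) /\
  {within @half_line R, continuous (derive_in (@half_line R) f)}.

Definition C1_amplitude (R : realType) (a : R -> complex R) :=
  C1_half_line (fun r => complex.Re (a r)) /\
  C1_half_line (fun r => complex.Im (a r)).

Definition sqmod (R : realType) (z : complex R) : R := Normc.normc z ^+ 2.

Definition dt (R : realType) (T : R) (f : R -> R -> R) (t r : R) : R :=
  derive_in (time_itv T) (fun s => f s r) t.

Definition dr (R : realType) (f : R -> R -> R) (t r : R) : R :=
  derive_in (@half_line R) (f t) r.

Definition spacetime (R : realType) (T : R) : set (R * R) :=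
  time_itv T `*` @half_line R.

Definition C1_spacetime (R : realType) (T : R) (f : R -> R -> R) :=
  [/\ {within spacetime T, continuous (fun p : R * R => f p.1 p.2)},
      forall t r, 0 <= t < T -> 0 <= r ->
        derivable_in (time_itv T) (fun s => f s r) t /\
        derivable_in (@half_line R) (f t) r,
      {within spacetime T, continuous (fun p : R * R => dt T f p.1 p.2)} &
      {within spacetime T, continuous (fun p : R * R => dr f p.1 p.2)}].

(* The Poisson equation dr (r^(n-1) dr V) = rho r^(n-1) is used in integrated
   form.  At r = 0 it reads 0 = 0, but there differentiability of V t forces
   dr V t 0 = 0.  The vanishing of the flux rho v r^(n-1) at r = 0 is automatic
   for n >= 2, since rho and v are finite there. *)
Definition EP_solution (R : realType) (n : nat) (lambda : R)
    (a0 : R -> complex R) (T : R) (rho v : R -> R -> R) :=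
  [/\ C1_spacetime T rho, C1_spacetime T v,
      exists V : R -> R -> R, forall t r, 0 <= t < T -> 0 <= r ->
        [/\ dt T (fun s x => rho s x * x ^+ n.-1) t r
              + dr (fun s x => rho s x * v s x * x ^+ n.-1) t r = 0,
            dt T v t r + v t r * dr v t r
              - lambda * t ^+ (n - 4) * dr V t r = 0,
            derivable_in (@half_line R) (V t) r &
            r ^+ n.-1 * dr V t r =
              \int[lebesgue_measure]_(s in `[0, r]) (rho t s * s ^+ n.-1)],
      forall t, 0 <= t < T -> rho t 0 * v t 0 * 0 ^+ n.-1 = 0 &
      forall r, 0 <= r -> rho 0 r = sqmod (a0 r) /\ v 0 r = 0].

(* T = 0 is always admissible (the time interval is then empty), so the
   supremum is nonnegative; it is +oo for global solutions. *)
Definition max_existence_time (R : realType) (n : nat) (lambda : R)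
    (a0 : R -> complex R) : \bar R :=
  ereal_sup [set T%:E | T in [set T : R | 0 <= T /\
    exists rho v : R -> R -> R, EP_solution n lambda a0 T rho v]].

Definition mass_ratio (R : realType) (n : nat) (a0 : R -> complex R)
    (r : R) : R :=
  (r ^+ n)^-1 *
  \int[lebesgue_measure]_(s in `[0, r]) (sqmod (a0 s) * s ^+ n.-1).

Definition mean_mass (R : realType) (n : nat) (a0 : R -> complex R)
    (r : R) : R :=
  if r == 0 then lim (mass_ratio n a0 r @[r --> 0^'+]) else mass_ratio n a0 r.

(* Extended-real arithmetic, with 0^-1 = +oo and (+oo)^-1 = 0: the value is 0
   when the mean mass is unbounded, and would be +oo if it were zero. *)
Definition breakdown_time (R : realType) (n : nat) (lambda : R)
    (a0 : R -> complex R) : \bar R :=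
  ((((n - 2) * (n - 3))%:R%:E /
    (`|lambda|%:E *
     ereal_sup [set (mean_mass n a0 r)%:E | r in @half_line R]))
   `^ (n - 2)%:R^-1)%E.

(* Main.v *)
Require Import Defs.
From mathcomp Require Import all_boot all_order all_algebra.
From mathcomp Require Import complex ring lra.
From mathcomp Require Import all_classical all_reals all_analysis.

Set Implicit Arguments.
Unset Strict Implicit.
Unset Printing Implicit Defensive.

Import Order.TTheory GRing.Theory Num.Theory.
Import numFieldNormedType.Exports.

Local Open Scope classical_set_scope.
Local Open Scope ring_scope.

(* The mass [m t r] enclosed in the ball of radius [r] is transported by [v], and
   along a characteristic [R' = v t R] started at [r0] the momentum equation reads
   [R'' = - |lambda| t^(n-4) m / R^(n-1)] with [m] constant.  Since [R <= r0], two
   integrations give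
     [R t <= r0 (1 - |lambda| M_0(r0) t^(n-2) / ((n-2)(n-3)))],
   while [R] cannot reach [0] because [m t r = O(r)] and [m > 0] along it.
   Instead of solving the characteristic equation, one follows Euler polygons
   [R(t+h) = R t + h v t (R t)]: uniform first-order expansions on a compact
   rectangle give all these relations up to an error [e * t], which suffices. *)

(** * Uniform continuity and boundedness on compact rectangles *)

Lemma compact_unif_continuous (R : realType) (X : pseudoMetricType R)
    (K : set X) (f : X -> R) : compact K -> {within K, continuous f} ->
  forall e : R, 0 < e -> exists2 d, 0 < d &
    forall x y, K x -> K y -> ball x d y -> `|f x - f y| <= e.
Proof.
move=> cK /subspace_continuousP cf e e0.
pose P (d : R) (x : X) :=
  K x -> forall y, K y -> ball x d y -> `|f x - f y| <= e.
(* Near-covering compactness: if [f] stays within [e / 2] of [f x] on the ball of radius [r], then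
   every [d < r / 2] serves all points of the ball of radius [r / 2], and compactness makes the
   choice of [d] uniform. *)
have : \forall d \near 0^'+, K `<=` P d.
  apply: (compact_near_coveringP K).1 => // x Kx.
  have /cvgrPdist_lt /(_ (e / 2) (divr_gt0 e0 (@ltr0Sn R 1))) := cf x Kx.
  rewrite near_withinE => /nbhs_ballP[/= r r0 xr].
  exists (ball x (r / 2), `]0, r / 2[%classic) => /=.
    split; first by apply: nbhsx_ballx; rewrite divr_gt0.
    near=> d; rewrite /= in_itv/=; apply/andP; split; near: d.
      exact: nbhs_right_gt.
    by apply: nbhs_right_lt; rewrite divr_gt0.
  move=> [x' d] /= [xx']; rewrite in_itv/= => /andP[d0 dr] Kx' y Ky x'y.
  have fx' : `|f x - f x'| < e / 2.
    by apply: xr => //; apply: le_ball xx'; lra.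
  have fy : `|f x - f y| < e / 2.
    apply: xr => //; rewrite [r]splitr; apply: ball_triangle xx' _.
    by apply: le_ball x'y; exact: ltW.
  rewrite distrC in fx'.
  by have := ler_distD (f x) (f x') (f y); lra.
move=> Pd; near (0 : R)^'+ => d; exists d; first by near: d; exact: nbhs_right_gt.
have KP : K `<=` P d by near: d.
by move=> x y Kx; apply: KP.
Unshelve. all: by end_near. Qed.

Lemma rect_unif_continuous (R : realType) (T L : R) (f : R -> R -> R) :
  {within `[0, T] `*` `[0, L], continuous (fun p : R * R => f p.1 p.2)} ->
  forall e : R, 0 < e -> exists2 d, 0 < d &
    forall t t' r r', 0 <= t <= T -> 0 <= t' <= T -> 0 <= r <= L ->
      0 <= r' <= L -> `|t - t'| < d -> `|r - r'| < d ->
      `|f t r - f t' r'| <= e.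
Proof.
move=> cf e e0.
have [|d d0 fd] := compact_unif_continuous _ cf e0.
  by apply: compact_setX; exact: segment_compact.
exists d => // t t' r r' tT t'T rL r'L tt' rr'.
by apply: (fd (t, r) (t', r')); rewrite /= ?in_itv/=.
Qed.

Lemma rect_bounded (R : realType) (T L : R) (f : R -> R -> R) :
  {within `[0, T] `*` `[0, L], continuous (fun p : R * R => f p.1 p.2)} ->
  exists2 C, 0 < C &
    forall t r, 0 <= t <= T -> 0 <= r <= L -> `|f t r| <= C.
Proof.
move=> cf.
have /compact_bounded[M [Mreal HM]] :
    compact ((fun p : R * R => f p.1 p.2) @` (`[0, T] `*` `[0, L])).
  apply: continuous_compact => //.
  by apply: compact_setX; exact: segment_compact.
exists (`|M| + 1); first by rewrite ltr_wpDl.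
move=> t r tT rL; apply: (HM (`|M| + 1)); first by rewrite ltr_pwDr ?ler_norm.
by exists (t, r); rewrite //= !in_itv.
Qed.

(** * Relative derivatives compared with ordinary ones *)

Lemma dnbhs_within_interior (R : realType) (D U : set R) (x : R) :
  nbhs x D -> within D x^' U -> x^' U.
Proof.
rewrite /within /dnbhs /= => Dx UD.
have {}UD : nbhs x (fun y => y != x -> D y -> U y) by exact: UD.
have /filterS : nbhs x ((fun y => y != x -> D y -> U y) `&` D) by exact: filterI.
by apply=> y [UDy Dy] yx; exact: UDy.
Qed.

(** Near an interior point the restriction to [D] does not change the punctured filter. This gives
    access to the mean value theorem and to the product rule. *)
Lemma derive_in_is_derive (R : realType) (D : set R) (f : R -> R) (x : R) :
  nbhs x D -> derivable_in D f x -> is_derive x 1 f (derive_in D f x).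
Proof.
move=> Dx df.
have df_cvg : diff_quot f x @ x^' --> derive_in D f x.
  by move=> A /df; exact: dnbhs_within_interior.
have shift_cvg : (h + x) @[h --> 0^'] --> x^'.
  move=> A /=; rewrite /dnbhs /within /= => /nbhs_ballP[e /= e0 xA].
  apply/nbhs_ballP; exists e => //= h; rewrite /ball/= sub0r normrN => he h0.
  apply: xA; last by rewrite -subr_eq0 addrK.
  by rewrite /ball/= opprD addrCA subrr addr0 normrN.
have dq : (h^-1 *: (f (h *: 1 + x) - f x)) @[h --> 0^'] --> derive_in D f x.
  apply: cvg_trans (cvg_comp _ _ shift_cvg df_cvg); apply: near_eq_cvg.
  near=> h; rewrite /= /diff_quot addrK [_ *: _]mulrC.
  by rewrite [h *: 1]mulr1.
split; first by apply/cvg_ex; eexists; exact: dq.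
exact: cvg_lim dq.
Unshelve. all: by end_near. Qed.

(** Points slightly to the right of [t] stay in the interval, so relative limits are unique even at
    [t = 0]. *)
Lemma within_time_itv_proper (R : realType) (T t : R) :
  0 <= t < T -> ProperFilter (within (time_itv T) t^').
Proof.
move=> /andP[t0 tT]; apply: Build_ProperFilter.
rewrite /within /dnbhs /= => /nbhs_ballP[e /= e0 tA].
pose y := t + Num.min e (T - t) / 2.
have m0 : 0 < Num.min e (T - t) by rewrite lt_min e0 subr_gt0.
have me : Num.min e (T - t) <= e by rewrite ge_min lexx.
have mT : Num.min e (T - t) <= T - t by rewrite ge_min lexx orbT.
apply: (tA y).
- rewrite /ball/= /y opprD addrA subrr sub0r normrN ger0_norm; lra.
- by rewrite /y gt_eqF// ltrDl; lra.
- by rewrite /time_itv/= /y; lra.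
Qed.

Lemma dtM_space (R : realType) (T t r : R) (f : R -> R -> R) (g : R -> R) :
  0 <= t < T -> derivable_in (time_itv T) (fun s => f s r) t ->
  dt T (fun s x => f s x * g x) t r = dt T f t r * g r.
Proof.
move=> tT df; rewrite /dt /derive_in.
have PF := within_time_itv_proper tT.
have -> : diff_quot (fun s => f s r * g r) t =
    (fun y => diff_quot (fun s => f s r) t y * g r).
  by apply/funext => y; rewrite /diff_quot -mulrBl mulrAC.
by apply: cvg_lim => //; apply: cvgMr_tmp.
Qed.

(** The source of every first-order expansion below: a bound on the oscillation of the derivative
    becomes a bound on the remainder. *)
Lemma MVT_le (R : realType) (f df : R -> R) (a b m e : R) : a <= b ->
  (forall x, x \in `]a, b[ -> is_derive x 1 f (df x)) ->
  {within `[a, b], continuous f} ->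
  (forall x, x \in `[a, b] -> `|df x - m| <= e) ->
  `|f b - f a - (b - a) * m| <= e * (b - a).
Proof.
move=> ab fd cf dfe; have [c cab ->] := MVT_segment ab fd cf.
rewrite mulrC -mulrBr normrM ger0_norm ?subr_ge0// mulrC.
by apply: ler_wpM2r; rewrite ?subr_ge0 ?dfe.
Qed.

Lemma derivable_in_interior (R : realType) (D : set R) (f : R -> R) (x : R) :
  derivable f x 1 -> derivable_in D f x.
Proof.
move=> /cvg_ex[l /= fl]; apply/cvg_ex; exists l.
have shift_cvg : (y - x) @[y --> x^'] --> 0^'.
  move=> A /=; rewrite /dnbhs /within /= => /nbhs_ballP[e /= e0 xA].
  suff : nbhs x [set y | y != x -> A (y - x)] by [].
  apply/nbhs_ballP; exists e => //= y; rewrite /ball/= => ye yx.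
  apply: xA; last by rewrite subr_eq0.
  by rewrite /ball/= sub0r normrN distrC.
have dq : diff_quot f x @ x^' --> l.
  apply: cvg_trans (cvg_comp _ _ shift_cvg fl); apply: near_eq_cvg.
  near=> y; rewrite /= /diff_quot [_ *: _]mulrC.
  by rewrite [(y - x) *: 1]mulr1 subrK.
by apply: cvg_trans dq; apply: cvg_app; exact: cvg_within.
Unshelve. all: by end_near. Qed.

(** * Restriction to compact rectangles and to slices *)

Lemma modulus_within_continuous (R : realType) (K : set R) (f : R -> R) :
  (forall e : R, 0 < e -> exists2 d, 0 < d &
    forall x y, K x -> K y -> `|x - y| < d -> `|f x - f y| <= e) ->
  {within K, continuous f}.
Proof.
move=> fK; apply/subspace_continuousP => x Kx; apply/cvgrPdist_le => e /fK[d d0 fd].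
suff : nbhs x [set y | K y -> `|f x - f y| <= e] by [].
by apply/nbhs_ballP; exists d => //= y xy Ky; exact: fd.
Qed.

Lemma spacetime_rect (R : realType) (T T1 L : R) (f : R * R -> R) : T1 < T ->
  {within spacetime T, continuous f} ->
  {within `[0, T1] `*` `[0, L], continuous f}.
Proof.
move=> T1T; apply: continuous_subspaceW => -[t r] /=; rewrite !in_itv/=.
by move=> [/andP[t0 tT] /andP[r0 _]]; split => //=; rewrite /time_itv/= t0 (le_lt_trans tT).
Qed.

Lemma within_slice_time (R : realType) (T r : R) (f : R -> R -> R) : 0 <= r ->
  {within `[0, T] `*` `[0, r], continuous (fun p : R * R => f p.1 p.2)} ->
  {within `[0, T], continuous (f ^~ r)}.
Proof.
move=> r0 cf; apply: modulus_within_continuous => e e0.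
have [d d0 fd] := rect_unif_continuous cf e0; exists d => // x y.
rewrite /= !in_itv/= => xT yT xy.
by apply: fd; rewrite ?lexx ?andbT// subrr normr0.
Qed.

Lemma within_slice_space (R : realType) (t L : R) (f : R -> R -> R) : 0 <= t ->
  {within `[0, t] `*` `[0, L], continuous (fun p : R * R => f p.1 p.2)} ->
  {within `[0, L], continuous (f t)}.
Proof.
move=> t0 cf; apply: modulus_within_continuous => e e0.
have [d d0 fd] := rect_unif_continuous cf e0; exists d => // x y.
rewrite /= !in_itv/= => xT yT xy.
by apply: fd; rewrite ?lexx ?andbT// subrr normr0.
Qed.

Lemma half_line_interior (R : realType) (r : R) : 0 < r -> nbhs r (@half_line R).
Proof. by move=> r0; near=> y; rewrite /half_line/= ltW//; near: y; exact: lt_nbhsr.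
Unshelve. all: by end_near. Qed.

Lemma time_itv_interior (R : realType) (T t : R) : 0 < t < T -> nbhs t (time_itv T).
Proof.
move=> /andP[t0 tT]; near=> y; rewrite /time_itv/=; apply/andP; split; last first.
  by near: y; exact: lt_nbhsl.
by apply: ltW; near: y; exact: lt_nbhsr.
Unshelve. all: by end_near. Qed.

(** * First-order expansions in time and in space, uniform on a rectangle *)

Lemma C1_dt_increment (R : realType) (T T1 L : R) (f : R -> R -> R) :
  T1 < T -> C1_spacetime T f ->
  forall e : R, 0 < e -> exists2 d, 0 < d &
    forall t t' r, 0 <= t -> t <= t' -> t' <= T1 -> 0 <= r <= L -> t' - t < d ->
      `|f t' r - f t r - (t' - t) * dt T f t r| <= e * (t' - t).
Proof.
move=> T1T [cf df ctf _] e e0.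
have [d d0 fd] := rect_unif_continuous (spacetime_rect (L := L) T1T ctf) e0.
exists d => // t t' r t0 tt' t'T1 /andP[r0 rL] ttd.
apply: (@MVT_le R (f ^~ r) (fun s => dt T f s r)) => //.
- move=> x; rewrite in_itv/= => /andP[tx xt'].
  (* The mean value theorem differentiates only at interior times, where the relative derivative is
     two-sided; the endpoint 0 enters through continuity alone. *)
  have xT : 0 < x < T by lra.
  by apply: derive_in_is_derive; [exact: time_itv_interior|
    apply: (df x r _ r0).1; lra].
- apply: (@continuous_subspaceW _ _ _ `[0, T1]).
    by move=> x /=; rewrite !in_itv/=; lra.
  by apply: within_slice_time => //; exact: spacetime_rect T1T cf.
- move=> x; rewrite in_itv/= => /andP[tx xt'].
  apply: fd; rewrite ?r0 ?subrr ?normr0//; first lra; first lra.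
  by rewrite ger0_norm; lra.
Qed.

(** The derivative [g] is a separate argument so that the lemma serves both the [C^1] fields and the
    enclosed mass, whose radial derivative is known for [0 < r]. *)
Lemma dr_increment (R : realType) (T1 L : R) (f g : R -> R -> R) :
  (forall t r : R, 0 <= t <= T1 -> 0 < r -> is_derive r 1 (f t) (g t r)) ->
  (forall t, 0 <= t <= T1 -> {within `[0, L], continuous (f t)}) ->
  {within `[0, T1] `*` `[0, L], continuous (fun p : R * R => g p.1 p.2)} ->
  forall e : R, 0 < e -> exists2 d, 0 < d &
    forall t r r', 0 <= t <= T1 -> 0 <= r <= L -> 0 <= r' <= L ->
      `|r' - r| < d ->
      `|f t r' - f t r - (r' - r) * g t r| <= e * `|r' - r|.
Proof.
move=> df cf cg e e0.
have [d d0 gd] := rect_unif_continuous cg e0.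
exists d => // t r r' tT1 rL r'L rr'd.
have seg a b : 0 <= a <= L -> 0 <= b <= L -> a <= b -> `|b - a| < d ->
    forall c, c \in `[a, b] -> `|f t b - f t a - (b - a) * g t c| <= e * (b - a).
  move=> aL bL ab; rewrite ger0_norm ?subr_ge0// => abd c.
  rewrite in_itv/= => cab; apply: (@MVT_le R (f t) (g t)) => //.
  - by move=> x; rewrite in_itv/= => xab; apply: df => //; lra.
  - apply: (@continuous_subspaceW _ _ _ `[0, L]); last exact: cf.
    by move=> x /=; rewrite !in_itv/=; lra.
  - move=> x; rewrite in_itv/= => xab.
    apply: gd; rewrite ?subrr ?normr0//; [lra|lra|].
    by rewrite ltr_norml; lra.
have [rr'|/ltW r'r] := leP r r'.
  by rewrite [in leRHS]ger0_norm ?subr_ge0//; apply: seg => //; rewrite in_itv/= lexx.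
rewrite distrC in rr'd; rewrite [in leRHS]distrC [in leRHS]ger0_norm ?subr_ge0//.
have := seg _ _ r'L rL r'r rr'd r; rewrite in_itv/= lexx r'r => /(_ isT).
by rewrite -normrN; congr (`|_| <= _); ring.
Qed.

Lemma C1_dr_increment (R : realType) (T T1 L : R) (f : R -> R -> R) :
  T1 < T -> C1_spacetime T f ->
  forall e : R, 0 < e -> exists2 d, 0 < d &
    forall t r r', 0 <= t <= T1 -> 0 <= r <= L -> 0 <= r' <= L ->
      `|r' - r| < d ->
      `|f t r' - f t r - (r' - r) * dr f t r| <= e * `|r' - r|.
Proof.
move=> T1T [cf df _ crf]; apply: dr_increment; last exact: spacetime_rect crf.
- move=> t r tT1 r0; apply: derive_in_is_derive; first exact: half_line_interior.
  by apply: (df t r _ _).2; lra.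
- move=> t tT1; apply: within_slice_space; first by lra.
  by apply: spacetime_rect cf; lra.
Qed.

(** * The enclosed mass and its flux *)

Lemma half_line_continuous_is_derive (R : realType) (g : R -> R) (r : R) :
  {within @half_line R, continuous g} -> 0 < r ->
  is_derive r 1 (fun x : R => \int[lebesgue_measure]_(s in `[0, x]) g s) (g r).
Proof.
move=> cg r0.
have r1 : r < r + 1 by rewrite ltrDl.
have ig : lebesgue_measure.-integrable `[0, r + 1] (EFin \o g).
  apply: continuous_compact_integrable; first exact: segment_compact.
  by apply: continuous_subspaceW cg => x /=; rewrite in_itv/= => /andP[].
have gr : {for r, continuous g}.
  have /subspace_continuousP /(_ r (ltW r0)) := cg.
  by rewrite within_interior//; apply: half_line_interior.
have [dF F'] := continuous_FTC1_closed r1 ig r0 gr.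
by split; rewrite // -derive1E.
Qed.

Lemma half_line_continuous_integral (R : realType) (g : R -> R) (L : R) :
  {within @half_line R, continuous g} ->
  {within `[0, L], continuous
    (fun x : R => \int[lebesgue_measure]_(s in `[0, x]) g s)}.
Proof.
move=> cg; have [L0|L0] := ltP L 0.
  by rewrite set_itv_ge -?ltNge//; exact: continuous_subspace0.
apply: parameterized_integral_continuous => //.
apply: continuous_compact_integrable; first exact: segment_compact.
by apply: continuous_subspaceW cg => x /=; rewrite in_itv/= => /andP[].
Qed.

Lemma spacetime_slice (R : realType) (T t : R) (f : R -> R -> R) :
  0 <= t < T -> {within spacetime T, continuous (fun p : R * R => f p.1 p.2)} ->
  {within @half_line R, continuous (f t)}.
Proof.
move=> tT /subspace_continuousP cf; apply/subspace_continuousP => r r0.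
apply: cvg_trans (cf (t, r) _) => //.
move=> A /= [[U V] /= [Ut Vr] UVA].
have : nbhs r [set y | V y] by exact: Vr.
rewrite nbhs_filterE/=; apply: filterS => y Vy y0.
by apply: (UVA (t, y)) => //=; split => //; exact: nbhs_singleton.
Qed.

Lemma continuous_snd_exp (R : realType) (k : nat) :
  continuous (fun p : R * R => p.2 ^+ k).
Proof.
by move=> p; apply: (@continuous_comp _ _ _ snd (@GRing.exp R ^~ k));
  [exact: cvg_snd | exact: exprn_continuous].
Qed.

Lemma within_continuousM (R : realType) (X : topologicalType) (K : set X)
    (f g : X -> R) : {within K, continuous f} -> {within K, continuous g} ->
  {within K, continuous (fun x => f x * g x)}.
Proof. by move=> cf cg x; apply: cvgM; [exact: cf | exact: cg]. Qed.

Definition enclosed_mass (R : realType) (k : nat) (rho : R -> R -> R) (t r : R) : R :=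
  \int[lebesgue_measure]_(s in `[0, r]) (rho t s * s ^+ k).

Lemma enclosed_mass0 (R : realType) (k : nat) (rho : R -> R -> R) (t : R) :
  enclosed_mass k rho t 0 = 0.
Proof. by rewrite /enclosed_mass set_itv1 Rintegral_set1. Qed.

Lemma C1_spacetime_is_derive (R : realType) (T t r : R) (f : R -> R -> R) :
  C1_spacetime T f -> 0 <= t < T -> 0 < r -> is_derive r 1 (f t) (dr f t r).
Proof.
move=> [_ df _ _] tT r0; apply: derive_in_is_derive.
  exact: half_line_interior.
exact: (df t r tT (ltW r0)).2.
Qed.

Lemma density_continuous (R : realType) (T t : R) (k : nat) (rho : R -> R -> R) :
  0 <= t < T -> C1_spacetime T rho ->
  {within @half_line R, continuous (fun s => rho t s * s ^+ k)}.
Proof.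
move=> tT [crho _ _ _]; apply: within_continuousM.
  exact: spacetime_slice crho.
by apply: continuous_subspaceT => x; exact: exprn_continuous.
Qed.

Lemma enclosed_mass_is_derive (R : realType) (T t r : R) (k : nat) (rho : R -> R -> R) :
  0 <= t < T -> 0 < r -> C1_spacetime T rho ->
  is_derive r 1 (enclosed_mass k rho t) (rho t r * r ^+ k).
Proof.
move=> tT r0 Crho.
exact: (half_line_continuous_is_derive (density_continuous (k := k) tT Crho) r0).
Qed.

Lemma enclosed_mass_continuous (R : realType) (T t L : R) (k : nat) (rho : R -> R -> R) :
  0 <= t < T -> C1_spacetime T rho ->
  {within `[0, L], continuous (enclosed_mass k rho t)}.
Proof.
move=> tT Crho; apply: half_line_continuous_integral.
exact: density_continuous Crho.
Qed.

Lemma flux_continuous (R : realType) (T : R) (k : nat) (rho v : R -> R -> R) :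
  C1_spacetime T rho -> C1_spacetime T v ->
  {within spacetime T, continuous (fun p : R * R => rho p.1 p.2 * v p.1 p.2 * p.2 ^+ k)}.
Proof.
move=> [cr _ _ _] [cv _ _ _].
apply: within_continuousM; first exact: within_continuousM.
by apply: continuous_subspaceT; exact: continuous_snd_exp.
Qed.

Definition mass_balance (R : realType) (T : R) (k : nat) (rho v : R -> R -> R) :=
  forall t r, 0 <= t < T -> 0 <= r ->
    dt T (fun s x => rho s x * x ^+ k) t r
      + dr (fun s x => rho s x * v s x * x ^+ k) t r = 0.

(** The product rule shows that the flux is differentiable; the mass balance then identifies its
    derivative, the weight [x ^+ k] being constant in time. *)
Lemma flux_is_derive (R : realType) (T t r : R) (k : nat) (rho v : R -> R -> R) :
  C1_spacetime T rho -> C1_spacetime T v -> mass_balance T k rho v ->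
  0 <= t < T -> 0 < r ->
  is_derive r 1 (fun x => rho t x * v t x * x ^+ k) (- (dt T rho t r * r ^+ k)).
Proof.
move=> Crho Cv bal tT r0.
have drho := C1_spacetime_is_derive Crho tT r0.
have dv := C1_spacetime_is_derive Cv tT r0.
have dJ : derivable (fun x => rho t x * v t x * x ^+ k) r 1.
  by apply: derivableM; [exact: derivableM|exact: exprn_derivable].
have -> : - (dt T rho t r * r ^+ k) =
    derive_in (@half_line R) (fun x => rho t x * v t x * x ^+ k) r.
  have := bal t r tT (ltW r0); rewrite dtM_space//.
    by move/eqP; rewrite addrC addr_eq0 => /eqP <-.
  by have [_ drh _ _] := Crho; exact: (drh t r tT (ltW r0)).1.
apply: derive_in_is_derive; first exact: half_line_interior.
exact: derivable_in_interior.
Qed.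

(** The continuity equation integrated over a ball: mass is lost at the rate of the boundary
    flux. *)
Lemma enclosed_mass_dt_increment (R : realType) (T T1 L : R) (k : nat)
    (rho v : R -> R -> R) : T1 < T -> (0 < k)%N -> 0 <= L ->
  C1_spacetime T rho -> C1_spacetime T v -> mass_balance T k rho v ->
  forall e : R, 0 < e -> exists2 d, 0 < d &
    forall t t' r, 0 <= t -> t <= t' -> t' <= T1 -> 0 <= r <= L -> t' - t < d ->
      `|enclosed_mass k rho t' r - enclosed_mass k rho t r
        + (t' - t) * (rho t r * v t r * r ^+ k)| <= e * (t' - t).
Proof.
move=> T1T k0 L0 Crho Cv bal e e0.
(* Integrating an error [e' * h] against [s ^+ k] over [[0, r]] costs at most [L ^+ k * L]; the 1
   keeps the divisor positive when [L = 0]. *)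
have Lk0 : 0 < L ^+ k * L + 1 by rewrite ltr_wpDl// mulr_ge0// exprn_ge0.
pose e' := e / (L ^+ k * L + 1).
have e'0 : 0 < e' by rewrite divr_gt0.
have [d d0 rhod] := C1_dt_increment L T1T Crho e'0.
exists d => // t t' r t0 tt' t'T1 /andP[r0 rL] ttd.
pose h := t' - t; have h0 : 0 <= h by rewrite /h subr_ge0.
have tT : 0 <= t < T by lra.
have t'T : 0 <= t' < T by lra.
(* By the mass balance the derivative of [D] is a time increment of [rho] minus its
   linear part, so no differentiation under the integral sign is needed. *)
pose D s := enclosed_mass k rho t' s - enclosed_mass k rho t s
        + h * (rho t s * v t s * s ^+ k).
pose D' s := (rho t' s - rho t s - h * dt T rho t s) * s ^+ k.
have dD (x : R) : 0 < x -> is_derive x 1 D (D' x).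
  move=> x0.
  have d1 := enclosed_mass_is_derive k t'T x0 Crho.
  have d2 := enclosed_mass_is_derive k tT x0 Crho.
  have d3 := flux_is_derive Crho Cv bal tT x0.
  have -> : D' x = (rho t' x * x ^+ k - rho t x * x ^+ k) +
      h *: (- (dt T rho t x * x ^+ k)).
    by rewrite /D' /GRing.scale/=; ring.
  by apply: is_deriveD; apply: is_deriveZ.
have cD : {within `[0, r], continuous D}.
  have c1 := enclosed_mass_continuous (L := r) (k := k) t'T Crho.
  have c2 := enclosed_mass_continuous (L := r) (k := k) tT Crho.
  have c3 : {within `[0, r], continuous (fun s => rho t s * v t s * s ^+ k)}.
    apply: (@continuous_subspaceW _ _ _ (@half_line R)).
      by move=> x /=; rewrite in_itv/= => /andP[].
    apply: (spacetime_slice (f := fun t x => rho t x * v t x * x ^+ k) tT).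
    exact: flux_continuous.
  move=> x; apply: cvgD; first by apply: cvgB; [exact: c1|exact: c2].
  by apply: cvgM; [exact: cvg_cst|exact: c3].
(* No flux enters at the center, since [0 < k]. *)
have D0 : D 0 = 0 by rewrite /D !enclosed_mass0 expr0n -[k == 0%N]negbK -lt0n k0/=; ring.
have := @MVT_le R D D' 0 r 0 (e' * h * L ^+ k) r0.
rewrite D0 mulr0 !subr0 => H.
have {}H : `|D r| <= e' * h * L ^+ k * r.
  apply: H => //.
  - by move=> x; rewrite in_itv/= => /andP[x0 _]; exact: dD.
  - move=> x; rewrite in_itv/= => /andP[x0 xr]; rewrite subr0 /D' normrM.
    apply: ler_pM => //.
      by apply: rhod => //; rewrite x0 (le_trans xr).
    by rewrite ger0_norm ?exprn_ge0// lerXn2r ?nnegrE//; lra.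
apply: (le_trans H).
have -> : e = e' * (L ^+ k * L + 1) by rewrite /e' divfK// gt_eqF.
have : L ^+ k * r <= L ^+ k * L by rewrite ler_wpM2l// exprn_ge0.
have : 0 <= e' * h by rewrite mulr_ge0// ltW.
rewrite -/h => P Q.
have := ler_wpM2l P (le_trans Q (ler_wpDr ler01 (lexx _))).
by congr (_ <= _); ring.
Qed.

(** * Increments along the velocity field *)

Lemma advection_increment (R : realType) (T1 L : R) (f ft fr v : R -> R -> R) :
  (forall e : R, 0 < e -> exists2 d, 0 < d &
    forall t t' r, 0 <= t -> t <= t' -> t' <= T1 -> 0 <= r <= L -> t' - t < d ->
      `|f t' r - f t r - (t' - t) * ft t r| <= e * (t' - t)) ->
  (forall e : R, 0 < e -> exists2 d, 0 < d &
    forall t r r', 0 <= t <= T1 -> 0 <= r <= L -> 0 <= r' <= L ->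
      `|r' - r| < d ->
      `|f t r' - f t r - (r' - r) * fr t r| <= e * `|r' - r|) ->
  {within `[0, T1] `*` `[0, L], continuous (fun p : R * R => ft p.1 p.2)} ->
  {within `[0, T1] `*` `[0, L], continuous (fun p : R * R => v p.1 p.2)} ->
  forall e : R, 0 < e -> exists2 d, 0 < d &
    forall t h r, 0 <= t -> 0 <= h -> t + h <= T1 -> 0 <= r <= L ->
      0 <= r + h * v t r <= L -> h < d ->
      `|f (t + h) (r + h * v t r) - f t r - h * (ft t r + v t r * fr t r)|
        <= e * h.
Proof.
move=> Hdt Hdr cft cv e e0.
have [B B0 vB] := rect_bounded cv.
have B2 : 0 < 2 + B by lra.
(* Two errors [e' * h] come from the time expansion at [r'] and from moving [ft] back to [r]; the
   space expansion over a displacement of at most [h * B] adds [e' * (h * B)]. *)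
pose e' := e / (2 + B); have e'0 : 0 < e' by rewrite divr_gt0.
have [d1 d10 H1] := Hdt _ e'0.
have [d2 d20 H2] := Hdr _ e'0.
have [d3 d30 H3] := rect_unif_continuous cft e'0.
exists (Num.min d1 (Num.min (d2 / B) (d3 / B))).
  by rewrite !lt_min d10 !divr_gt0.
move=> t h r t0 h0 thT rL r'L; rewrite !lt_min => /and3P[hd1 hd2 hd3].
have tT : 0 <= t <= T1 by lra.
have hv : `|h * v t r| <= h * B.
  by rewrite normrM ger0_norm// ler_wpM2l// vB.
rewrite ltr_pdivlMr// in hd2; rewrite ltr_pdivlMr// in hd3.
set r' := r + h * v t r in r'L *.
have rr' : r' - r = h * v t r by rewrite /r' addrC addKr.
have := H1 t (t + h) r' t0; rewrite lerDl addrAC subrr add0r => /(_ h0 thT r'L hd1) A.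
have := H2 t r r' tT rL r'L; rewrite rr' => /(_ (le_lt_trans hv hd2)) Bd.
have C : `|ft t r' - ft t r| <= e'.
  apply: H3 => //; first by rewrite subrr normr0.
  by rewrite rr' (le_lt_trans hv).
have hC : `|h * (ft t r' - ft t r)| <= e' * h.
  by rewrite normrM ger0_norm// mulrC ler_wpM2r.
have Bd' : e' * `|h * v t r| <= e' * (h * B) by rewrite ler_wpM2l// ltW.
have -> : f (t + h) r' - f t r - h * (ft t r + v t r * fr t r) =
    (f (t + h) r' - f t r' - h * ft t r') +
    (f t r' - f t r - h * v t r * fr t r) + h * (ft t r' - ft t r) by ring.
have -> : e * h = e' * h + e' * (h * B) + e' * h.
  by rewrite -[in LHS](divfK (lt0r_neq0 B2) e) -/e'; ring.
apply: (le_trans (ler_normD _ _)); apply: lerD => //.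
apply: (le_trans (ler_normD _ _)); apply: lerD => //.
exact: le_trans Bd'.
Qed.

(** * Euler polygons and focusing *)

Lemma exprn_increment (R : realType) (T1 : R) (q : nat) : exists2 C : R, 0 <= C &
  forall t h, 0 <= t -> 0 <= h -> t + h <= T1 ->
    (t + h) ^+ q.+1 <= t ^+ q.+1 + q.+1%:R * h * t ^+ q + C * h ^+ 2.
Proof.
elim: q => [|q [C C0 IH]].
  by exists 0 => // t h *; rewrite !expr1 expr0; lra.
(* Multiplying the bound for [q] by [t + h] creates two terms of second order in [h], estimated
   through [t <= T1] and [t + h <= T1]. *)
exists (q.+1%:R * `|T1| ^+ q + C * `|T1|).
  by rewrite addr_ge0// mulr_ge0// exprn_ge0.
move=> t h t0 h0 thT.
have T1n := ler_norm T1.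
have th0 : 0 <= t + h by rewrite addr_ge0.
have tq : t ^+ q <= `|T1| ^+ q by rewrite lerXn2r ?nnegrE//; lra.
rewrite exprS; apply: (le_trans (ler_wpM2l th0 (IH t h t0 h0 thT))).
have h20 : 0 <= h ^+ 2 by rewrite exprn_ge0.
have A : q.+1%:R * h ^+ 2 * t ^+ q <= q.+1%:R * h ^+ 2 * `|T1| ^+ q.
  by rewrite ler_wpM2l// mulr_ge0.
have A' : C * h ^+ 2 * (t + h) <= C * h ^+ 2 * `|T1|.
  by rewrite ler_wpM2l ?mulr_ge0//; lra.
have -> : (t + h) * (t ^+ q.+1 + q.+1%:R * h * t ^+ q + C * h ^+ 2) =
  t ^+ q.+2 + q.+2%:R * h * t ^+ q.+1 + q.+1%:R * h ^+ 2 * t ^+ q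
    + C * h ^+ 2 * (t + h) by rewrite -(natr1 q.+1) !exprS; ring.
have -> : t ^+ q.+2 + q.+2%:R * h * t ^+ q.+1 + (q.+1%:R * `|T1| ^+ q + C * `|T1|) * h ^+ 2 =
  t ^+ q.+2 + q.+2%:R * h * t ^+ q.+1 + q.+1%:R * h ^+ 2 * `|T1| ^+ q
    + C * h ^+ 2 * `|T1| by ring.
by apply: lerD => //; apply: lerD.
Qed.

(* Strictness leaves room to lower the mass to [mu] and raise the radius to [r1],
   which absorbs the discretisation errors. *)
Lemma exists_weaker_datum (R : realType) (k : nat) (a b c m r0 : R) :
  0 < a -> 0 <= c -> 0 < r0 -> 0 < b -> c * r0 ^+ k < a * m ->
  exists mu r1, [/\ 0 < mu, mu < m, r0 < r1, r1 <= r0 + b & c * r1 ^+ k <= a * mu].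
Proof.
move=> a0 c0 r00 b0 cm.
have q0 : 0 <= c * r0 ^+ k / a by rewrite divr_ge0 ?(ltW a0)// mulr_ge0// exprn_ge0// ltW.
have qm : c * r0 ^+ k / a < m by rewrite ltr_pdivrMr// [m * a]mulrC.
pose mu := (c * r0 ^+ k / a + m) / 2.
have muq : c * r0 ^+ k < a * mu by rewrite [a * mu]mulrC -ltr_pdivrMr// /mu; lra.
have cont : c * x ^+ k @[x --> r0^'+] --> c * r0 ^+ k.
  by apply: cvg_at_right_filter; apply: cvgM; [exact: cvg_cst|exact: exprn_continuous].
near r0^'+ => r1; exists mu, r1; split.
- by rewrite /mu; lra.
- by rewrite /mu; lra.
- by near: r1; exact: nbhs_right_gt.
- by near: r1; apply: nbhs_right_le; rewrite ltrDl.
- by apply: ltW; near: r1; exact: (cvgr_lt _ cont).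
Unshelve. all: by end_near. Qed.

(* To first order, [f] changes at the rate [g] along the velocity field [v]. *)
Definition advected (R : realType) (T1 L : R) (v f g : R -> R -> R) :=
  forall e : R, 0 < e -> exists2 d, 0 < d &
    forall t h r, 0 <= t -> 0 <= h -> t + h <= T1 -> 0 <= r <= L ->
      0 <= r + h * v t r <= L -> h < d ->
      `|f (t + h) (r + h * v t r) - f t r - h * g t r| <= e * h.

Lemma polygon_induction (R : realType) (T1 d : R) (P : R -> R -> Prop) (r0 : R) :
  0 < T1 -> 0 < d -> P 0 r0 ->
  (forall t h r, 0 <= t -> 0 < h -> t + h <= T1 -> h < d -> P t r ->
    exists r', P (t + h) r') ->
  exists r, P T1 r.
Proof.
move=> T10 d0 P0 step.
(* With this many equal steps each is shorter than [d], and the last one ends exactly at [T1]. *)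
pose N := (Num.truncn (T1 / d)).+1.
have N0 : 0 < N%:R :> R by rewrite ltr0n.
pose h := T1 / N%:R.
have h0 : 0 < h by rewrite divr_gt0.
have hd : h < d.
  by rewrite /h ltr_pdivrMr// mulrC -ltr_pdivrMr// truncnS_gt.
have hN : N%:R * h = T1 by rewrite /h mulrC divfK// gt_eqF.
have {}step i : (i <= N)%N -> exists r, P (i%:R * h) r.
  elim: i => [_|i IH iN]; first by exists r0; rewrite mul0r.
  have [r Pr] := IH (ltnW iN).
  have hS : i.+1%:R * h = i%:R * h + h by rewrite -natr1; ring.
  rewrite hS; apply: step Pr => //; first by rewrite mulr_ge0// ltW.
  by rewrite -hS -hN ler_pM2r// ler_nat.
by have := step N (leqnn N); rewrite hN.
Qed.

(** By contradiction: if the inequality failed, a polygon from [r0] would have to reach the center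
    by time [T1], while its conserved positive mass keeps it at a positive distance. *)
Lemma focusing (R : realType) (T1 kap C r0 : R) (p k : nat)
    (m v a : R -> R -> R) :
  0 < T1 -> 0 < kap -> 0 < C -> 0 < r0 ->
  advected T1 (r0 + 1) v m (fun _ _ => 0) -> advected T1 (r0 + 1) v v a ->
  (forall t r, 0 <= t <= T1 -> 0 <= r <= r0 + 1 ->
    r ^+ k * a t r = - (kap * t ^+ p * m t r)) ->
  (forall t r, 0 <= t <= T1 -> 0 <= r <= r0 + 1 -> m t r <= C * r) ->
  (exists2 B, 0 < B & forall t r, 0 <= t <= T1 -> 0 <= r <= r0 + 1 -> `|v t r| <= B) ->
  v 0 r0 = 0 ->
  kap * T1 ^+ p.+2 * m 0 r0 <= (p.+2 * p.+1)%:R * r0 ^+ k.+1.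
Proof.
move=> T10 kap0 C0 r00 advm advv acc mC [B B0 vB] v0.
rewrite leNgt; apply/negP => contra.
have Tp0 : 0 < T1 ^+ p.+2 by rewrite exprn_gt0.
have a0 : 0 < kap * T1 ^+ p.+2 by rewrite mulr_gt0.
have half0 : 0 < 2^-1 :> R by rewrite invr_gt0.
have [mu [r1 [mu0 mum r01 r1L mur1]]] :=
  exists_weaker_datum a0 (ler0n R _) r00 half0 contra.
have r10 : 0 < r1 by lra.
have r1k : 0 < r1 ^+ k by rewrite exprn_gt0.
pose b := kap * mu / r1 ^+ k.
have b0 : 0 < b by rewrite !(divr_gt0, mulr_gt0).
have bE : b * r1 ^+ k = kap * mu by rewrite /b divfK// gt_eqF.
(* Up to time [T1], the first bound keeps the mass above [mu] and the second keeps the accumulated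
   position error within [r1 - r0]. *)
pose e := Num.min ((m 0 r0 - mu) / T1) ((r1 - r0) / ((2 * T1 + 1) * T1)).
have TT0 : 0 < (2 * T1 + 1) * T1 by rewrite mulr_gt0//; lra.
have e0 : 0 < e by rewrite lt_min !divr_gt0// subr_gt0.
have eT : e * T1 <= m 0 r0 - mu by rewrite -ler_pdivlMr// /e ge_min lexx.
have eTT : e * ((2 * T1 + 1) * T1) <= r1 - r0.
  by rewrite -ler_pdivlMr// /e ge_min lexx orbT.
have [d1 d10 Hm] := advm _ e0.
have [d2 d20 Hv] := advv _ e0.
have [C1 C10 P1] := exprn_increment T1 p.
have [C2 C20 P2] := exprn_increment T1 p.+1.
(* Mass at least [mu] together with [m t r <= C * r] forces [rs <= r]. *)
pose rs := mu / C; have rs0 : 0 < rs by rewrite divr_gt0.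
have p10 : 0 < p.+1%:R :> R by rewrite ltr0n.
have p20 : 0 < p.+2%:R :> R by rewrite ltr0n.
(* Coefficients of the first and second time integrals of [b * t ^+ p]. *)
pose b1 := b / p.+1%:R; pose b2 := b1 / p.+2%:R.
have b10 : 0 < b1 by rewrite divr_gt0.
have b20 : 0 < b2 by rewrite divr_gt0.
have b1E : b1 * p.+1%:R = b by rewrite /b1 divfK// gt_eqF.
have b2E : b2 * p.+2%:R = b1 by rewrite /b2 divfK// gt_eqF.
(* The bounds with [B] keep the next vertex in [[0, r0 + 1]], so that the expansions apply; the last
   two absorb the second-order remainders of the powers of [t] into [e * h]. *)
pose d := Num.min d1 (Num.min d2 (Num.min (2^-1 / B) (Num.min (rs / B)
  (Num.min (e / (b1 * C1 + 1)) (e / (b2 * C2 + 1)))))).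
have bC1 : 0 < b1 * C1 + 1 by rewrite ltr_wpDl// mulr_ge0// ltW.
have bC2 : 0 < b2 * C2 + 1 by rewrite ltr_wpDl// mulr_ge0// ltW.
have d0 : 0 < d by rewrite !lt_min d10 d20 !divr_gt0.
(* Velocity error grows at rate [2 * e], one [e] from expanding [v] and one from [t ^+ p.+1].
   Position error grows at rate at most [2 * e * T1] inherited from the velocity, plus [e] from
   [t ^+ p.+2]. *)
pose P t r := [/\ rs <= r, r <= r1, m 0 r0 - e * t <= m t r,
  v t r + b1 * t ^+ p.+1 <= 2 * e * t &
  r + b2 * t ^+ p.+2 <= r0 + e * (2 * T1 + 1) * t].
have [|t h r t0 h0 thT hd [rsr rr1 mt vt rt]|r [rsr _ _ _ rT]] :=
    @polygon_induction R T1 d P r0 T10 d0.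
- split.
  + rewrite /rs ler_pdivrMr// [r0 * C]mulrC.
    by apply: (le_trans (ltW mum)); apply: mC; lra.
  + exact: ltW.
  + by rewrite mulr0 subr0.
  + by rewrite v0 expr0n/= !mulr0 addr0.
  + by rewrite expr0n/= !mulr0 !addr0.
- move: hd; rewrite !lt_min => /and4P[hd1 hd2 + /and3P[]].
  rewrite !(ltr_pdivlMr _ _ B0) (ltr_pdivlMr _ _ bC1) (ltr_pdivlMr _ _ bC2).
  move=> hB1 hB2 hC1 hC2.
  have tT : 0 <= t <= T1 by lra.
  have rL : 0 <= r <= r0 + 1 by lra.
  have /ler_normlP[hv1 hv2] : `|h * v t r| <= h * B.
    by rewrite normrM gtr0_norm// ler_wpM2l ?vB// ltW.
  set r' := r + h * v t r.
  have r'L : 0 <= r' <= r0 + 1 by rewrite /r'; lra.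
  have {Hm} := Hm t h r t0 (ltW h0) thT rL r'L hd1.
  have {Hv} := Hv t h r t0 (ltW h0) thT rL r'L hd2.
  rewrite -/r' => /ler_normlP[_ Hv] /ler_normlP[Hm _].
  have et : e * t <= e * T1 by rewrite ler_wpM2l//; lra.
  have eth : e * (t + h) <= e * T1 by rewrite ler_wpM2l//; lra.
  have mmu : mu <= m t r by lra.
  have rk : 0 < r ^+ k by rewrite exprn_gt0//; lra.
  have tp : 0 <= t ^+ p by rewrite exprn_ge0.
  (* The attraction is weakest for the least mass [mu] and the largest radius [r1], which is how [b]
     was chosen. *)
  have acc_le : a t r <= - (b * t ^+ p).
    rewrite -(ler_pM2l rk) acc// mulrN lerN2 mulrA [r ^+ k * b]mulrC -[kap * _ * _]mulrAC.
    apply: ler_wpM2r => //.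
    apply: (@le_trans _ _ (kap * mu)); last by rewrite ler_pM2l.
    by rewrite -bE ler_pM2l// lerXn2r ?nnegrE//; lra.
  have hacc : h * a t r <= h * - (b * t ^+ p) by rewrite ler_pM2l.
  have m' : m 0 r0 - e * (t + h) <= m (t + h) r' by lra.
  have p1 : b1 * (t + h) ^+ p.+1 <= b1 * t ^+ p.+1 + h * (b * t ^+ p) + e * h.
    have := ler_wpM2l (ltW b10) (P1 t h t0 (ltW h0) thT).
    move/le_trans; apply.
    have -> : b1 * (t ^+ p.+1 + p.+1%:R * h * t ^+ p + C1 * h ^+ 2) =
       b1 * t ^+ p.+1 + h * ((b1 * p.+1%:R) * t ^+ p) + (h * (b1 * C1)) * h by ring.
    by rewrite b1E lerD2l ler_pM2r//; lra.
  have p2 : b2 * (t + h) ^+ p.+2 <= b2 * t ^+ p.+2 + h * (b1 * t ^+ p.+1) + e * h.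
    have := ler_wpM2l (ltW b20) (P2 t h t0 (ltW h0) thT).
    move/le_trans; apply.
    have -> : b2 * (t ^+ p.+2 + p.+2%:R * h * t ^+ p.+1 + C2 * h ^+ 2) =
       b2 * t ^+ p.+2 + h * ((b2 * p.+2%:R) * t ^+ p.+1) + (h * (b2 * C2)) * h by ring.
    by rewrite b2E lerD2l ler_pM2r//; lra.
  have hF : h * (v t r + b1 * t ^+ p.+1) <= h * (2 * e * T1).
    by rewrite ler_pM2l//; lra.
  have r'G : r' + b2 * (t + h) ^+ p.+2 <= r0 + e * (2 * T1 + 1) * (t + h).
    by rewrite /r'; lra.
  have eTth : e * (2 * T1 + 1) * (t + h) <= e * (2 * T1 + 1) * T1.
    by rewrite ler_wpM2l// mulr_ge0//; lra.
  have pos : 0 <= b2 * (t + h) ^+ p.+2.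
    by rewrite mulr_ge0 ?exprn_ge0//; lra.
  exists r'; split => //.
  (* The lower bound is not propagated from [r]: it is recovered from the mass at the new vertex. *)
  + rewrite /rs ler_pdivrMr// [r' * C]mulrC.
    by apply: (@le_trans _ _ (m (t + h) r')); [lra | apply: mC; lra].
  + lra.
  + lra.
(* This is [mur1] divided by [r1 ^+ k]. With the position bound at [T1] it makes the final radius
   nonpositive, against [rs <= r]. *)
have : r1 <= b2 * T1 ^+ p.+2.
  rewrite -(ler_pM2r r1k) -(ler_pM2l (mulr_gt0 p20 p10)).
  have -> : p.+2%:R * p.+1%:R * (b2 * T1 ^+ p.+2 * r1 ^+ k) =
    kap * T1 ^+ p.+2 * mu.
    by rewrite [RHS]mulrAC -bE -b1E -b2E; ring.
  by rewrite -exprS -natrM.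
lra.
Qed.

(** * Focusing applied to Euler-Poisson solutions *)

Lemma enclosed_mass_advected (R : realType) (T T1 L : R) (k : nat)
    (rho v : R -> R -> R) : T1 < T -> (0 < k)%N -> 0 <= L ->
  C1_spacetime T rho -> C1_spacetime T v -> mass_balance T k rho v ->
  advected T1 L v (enclosed_mass k rho) (fun _ _ => 0).
Proof.
move=> T1T k0 L0 Crho Cv bal.
have [crho _ _ _] := Crho; have [cv _ _ _] := Cv.
have cflux := spacetime_rect (L := L) T1T (flux_continuous (k := k) Crho Cv).
have cdens : {within `[0, T1] `*` `[0, L],
    continuous (fun p : R * R => rho p.1 p.2 * p.2 ^+ k)}.
  apply: within_continuousM; first exact: spacetime_rect T1T crho.
  by apply: continuous_subspaceT; exact: continuous_snd_exp.
move=> e e0.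
(* The time rate, minus the flux, cancels [v] times the radial derivative [rho t r * r ^+ k]. *)
have [|||//|d d0 Hd] := @advection_increment R T1 L (enclosed_mass k rho)
  (fun t r => - (rho t r * v t r * r ^+ k)) (fun t r => rho t r * r ^+ k) v _ _ _ _ e e0.
- move=> {}e {}e0.
  have [d d0 Hd] := enclosed_mass_dt_increment T1T k0 L0 Crho Cv bal e0.
  exists d => // t t' r t0 tt' t'T rL ttd.
  by rewrite mulrN opprK; exact: Hd.
- apply: (@dr_increment _ _ _ _ (fun t r => rho t r * r ^+ k)) => //.
  + move=> t r tT r0; apply: enclosed_mass_is_derive Crho => //; lra.
  + move=> t tT; apply: enclosed_mass_continuous Crho; lra.
- by move=> x; apply: cvgN; exact: cflux.
- exact: spacetime_rect T1T cv.
exists d => // t h r t0 h0 thT rL r'L hd.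
have := Hd t h r t0 h0 thT rL r'L hd.
by congr (`|_ - _| <= _); ring.
Qed.

Lemma velocity_advected (R : realType) (T T1 L : R) (v : R -> R -> R) :
  T1 < T -> C1_spacetime T v ->
  advected T1 L v v (fun t r => dt T v t r + v t r * dr v t r).
Proof.
move=> T1T Cv; have [cv _ cvt _] := Cv.
apply: advection_increment.
- exact: C1_dt_increment.
- exact: C1_dr_increment T1T Cv.
- exact: spacetime_rect T1T cvt.
- exact: spacetime_rect T1T cv.
Qed.

(** The radial derivative of the mass is bounded on the rectangle. This is what keeps polygons
    carrying positive mass away from the center. *)
Lemma enclosed_mass_linear_bound (R : realType) (T T1 L : R) (k : nat)
    (rho : R -> R -> R) : T1 < T -> C1_spacetime T rho ->
  exists2 C, 0 < C & forall t r, 0 <= t <= T1 -> 0 <= r <= L ->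
    enclosed_mass k rho t r <= C * r.
Proof.
move=> T1T Crho; have [crho _ _ _] := Crho.
have cdens : {within `[0, T1] `*` `[0, L],
    continuous (fun p : R * R => rho p.1 p.2 * p.2 ^+ k)}.
  apply: within_continuousM; first exact: spacetime_rect T1T crho.
  by apply: continuous_subspaceT; exact: continuous_snd_exp.
have [C C0 HC] := @rect_bounded R T1 L (fun t r => rho t r * r ^+ k) cdens.
exists C => // t r tT /andP[r0 rL].
have tT' : 0 <= t < T by lra.
have := @MVT_le R (enclosed_mass k rho t) (fun r => rho t r * r ^+ k) 0 r 0 C r0.
rewrite enclosed_mass0 mulr0 !subr0 => H.
apply: (le_trans (ler_norm _)); apply: H.
- by move=> x; rewrite in_itv/= => /andP[x0 _]; exact: enclosed_mass_is_derive Crho.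
- exact: enclosed_mass_continuous Crho.
- by move=> x; rewrite in_itv/= => /andP[x0 xr]; rewrite subr0; apply: HC => //; lra.
Qed.

Lemma EP_solution_mass_ratio (R : realType) (n : nat) (lambda T T1 r : R)
    (a0 : R -> complex R) (rho v : R -> R -> R) :
  lambda < 0 -> (4 <= n)%N -> EP_solution n lambda a0 T rho v ->
  0 < T1 -> T1 < T -> 0 < r ->
  `|lambda| * T1 ^+ (n - 2) * mass_ratio n a0 r <= ((n - 2) * (n - 3))%:R.
Proof.
(* Writing [n = p.+4] turns the truncated exponents [n - 4], [n - 2] and [n.-1] into [p], [p.+2] and
   [p.+3]. *)
case: n => [|[|[|[|p]]]]// lambda0 _ [Crho Cv [V EP] _ init] T10 T1T r0.
have -> : (p.+4 - 2 = p.+2)%N by rewrite !subSS subn0.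
have -> : (p.+4 - 3 = p.+1)%N by rewrite !subSS subn0.
have T0 : 0 < T by exact: lt_trans T1T.
have r10 : 0 <= r + 1 by rewrite addr_ge0// ltW.
have bal : mass_balance T p.+3 rho v.
  by move=> t x tT x0; have [] := EP t x tT x0.
have [C C0 HC] := enclosed_mass_linear_bound (r + 1) p.+3 T1T Crho.
have [cv _ _ _] := Cv.
have := @focusing R T1 `|lambda| C r p p.+3 (enclosed_mass p.+3 rho) v
  (fun t r => dt T v t r + v t r * dr v t r) T10.
rewrite normr_gt0 lt_eqF// => /(_ isT C0 r0) H.
have {}H : `|lambda| * T1 ^+ p.+2 * enclosed_mass p.+3 rho 0 r <=
    (p.+2 * p.+1)%:R * r ^+ p.+4.
  apply: H => //.
  - exact: enclosed_mass_advected T1T _ r10 Crho Cv bal.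
  - exact: velocity_advected T1T Cv.
  - move=> t x tT xL.
    have tT' : 0 <= t < T by lra.
    have x0 : 0 <= x by lra.
    have [_ Ev _ EV] := EP t x tT' x0.
    (* The Poisson equation replaces the mass by [x ^+ p.+3 * dr V t x], and the momentum equation
       gives the acceleration. *)
    rewrite /enclosed_mass -EV ltr0_norm//.
    have -> : dt T v t x + v t x * dr v t x = lambda * t ^+ p * dr V t x.
      by move/eqP: Ev; rewrite subr_eq0 !subSS subn0 => /eqP.
    by rewrite /=; ring.
  - have [B B0 HB] := rect_bounded (spacetime_rect (L := r + 1) T1T cv).
    by exists B.
  - by have [_] := init r (ltW r0).
have -> : mass_ratio p.+4 a0 r = (r ^+ p.+4)^-1 * enclosed_mass p.+3 rho 0 r.
  congr (_ * _); apply: eq_Rintegral => s; rewrite inE/= in_itv/= => /andP[s0 _].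
  by have [-> _] := init s s0.
by rewrite mulrCA mulrC ler_pdivrMr// exprn_gt0.
Qed.

(** * Positivity and bounds for the mean mass *)

Lemma derivable_in_continuous (R : realType) (D : set R) (f : R -> R) :
  (forall x, D x -> derivable_in D f x) -> {within D, continuous f}.
Proof.
move=> df; apply/subspace_continuousP => x Dx.
have [l dl] := proj1 (cvg_ex _) (df x Dx).
have FF : Filter (within D x^') by exact: within_filter.
have xx : y @[y --> within D x^'] --> x.
  by move=> A Ax; apply: cvg_within; apply: cvg_within; exact: Ax.
have fx : (f x + diff_quot f x y * (y - x)) @[y --> within D x^'] --> f x.
  rewrite -[X in _ --> X]addr0 -(mulr0 l) -(subrr x).
  apply: cvgD; first exact: cvg_cst.
  by apply: cvgM => //; apply: cvgB; [exact: xx|exact: cvg_cst].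
apply/cvgrPdist_le => e e0.
have /cvgrPdist_le/(_ e e0) := fx.
rewrite !near_withinE => fxe.
have {}fxe : nbhs x (fun y => y != x -> D y ->
  `|f x - (f x + diff_quot f x y * (y - x))| <= e) by exact: fxe.
suff : nbhs x (fun y => D y -> `|f x - f y| <= e) by [].
apply: filterS fxe => y H Dy.
have [->|yx] := eqVneq y x; first by rewrite subrr normr0 ltW.
have := H yx Dy; rewrite /diff_quot divfK ?subr_eq0//.
by rewrite subrKC.
Qed.

Lemma sqmodE (R : realType) (z : complex R) :
  sqmod z = complex.Re z ^+ 2 + complex.Im z ^+ 2.
Proof. by case: z => x y; rewrite /sqmod/= sqr_sqrtr// addr_ge0// sqr_ge0. Qed.

Lemma sqmod_gt0 (R : realType) (z : complex R) : z != 0 -> 0 < sqmod z.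
Proof.
rewrite sqmodE => z0; rewrite lt_def addr_ge0 ?sqr_ge0// andbT.
rewrite paddr_eq0 ?sqr_ge0// !sqrf_eq0; apply: contra z0.
by case: z => x y /= /andP[/eqP-> /eqP->].
Qed.

Lemma sqmod_continuous (R : realType) (a : R -> complex R) :
  C1_amplitude a -> {within @half_line R, continuous (fun s => sqmod (a s))}.
Proof.
move=> [[dRe _] [dIm _]].
have cRe := derivable_in_continuous dRe; have cIm := derivable_in_continuous dIm.
have -> : (fun s => sqmod (a s)) = (fun s => complex.Re (a s) * complex.Re (a s)
    + complex.Im (a s) * complex.Im (a s)).
  by apply/funext => s; rewrite sqmodE !expr2.
by move=> x; apply: cvgD; apply: within_continuousM.
Qed.

Lemma mean_mass_gt0 (R : realType) (n : nat) (a : R -> complex R) :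
  C1_amplitude a -> (exists2 r : R, 0 <= r & a r != 0) ->
  exists2 r : R, 0 <= r & 0 < mean_mass n a r.
Proof.
move=> Ca [r0 r00 ar0].
have cq := sqmod_continuous Ca.
have q0 := sqmod_gt0 ar0.
pose g s := sqmod (a s) * s ^+ n.-1.
have cg : {within @half_line R, continuous g}.
  apply: within_continuousM => //.
  by apply: continuous_subspaceT => x; exact: exprn_continuous.
have g0 s : 0 <= s -> 0 <= g s.
  move=> s0; apply: mulr_ge0; last exact: exprn_ge0.
  by rewrite sqmodE addr_ge0 ?sqr_ge0.
have /subspace_continuousP /(_ r0 r00) /cvgrPdist_lt /(_ _ q0) := cq.
rewrite near_withinE => Hq.
have /nbhs_ballP[d /= d0 Hd] : nbhs r0 (fun y => 0 <= y ->
  `|sqmod (a r0) - sqmod (a y)| < sqmod (a r0)) by exact: Hq.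
(* Only points strictly to the right of [r0] are used, so the weight is positive even when
   [r0 = 0]. *)
have gpos y : r0 < y -> y < r0 + d -> 0 < g y.
  move=> ry yd; apply: mulr_gt0; last by apply: exprn_gt0; exact: le_lt_trans ry.
  have : `|sqmod (a r0) - sqmod (a y)| < sqmod (a r0).
    have r0y : r0 <= y by exact: ltW.
    apply: Hd; last exact: le_trans r0y.
    by rewrite /ball/= ltr0_norm ?subr_lt0// opprB ltrBlDl.
  by rewrite ltr_norml => /andP[_]; rewrite gtrBl.
pose F x := \int[lebesgue_measure]_(s in `[0, x]) g s.
pose b := r0 + d / 2.
have [|||c] := @MVT R F g r0 b.
- by rewrite /b ltrDl divr_gt0.
- move=> x; rewrite in_itv/= => /andP[rx _].
  by apply: half_line_continuous_is_derive => //; exact: le_lt_trans rx.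
- apply: (@continuous_subspaceW _ _ _ `[0, b]); last exact: half_line_continuous_integral.
  by move=> x /=; rewrite !in_itv/=; lra.
rewrite in_itv/= => /andP[rc cb] Fb.
have gc : 0 < g c by apply: gpos => //; rewrite (lt_trans cb)// /b; lra.
have Fr0 : 0 <= F r0.
  by apply: Rintegral_ge0 => s /=; rewrite in_itv/= => /andP[s0 _]; exact: g0.
have brpos : 0 < b - r0 by lra.
have Fb0 : 0 < F b.
  by have := mulr_gt0 gc brpos; rewrite -Fb; lra.
have bpos : 0 < b by lra.
exists b; first exact: ltW.
rewrite /mean_mass gt_eqF// /mass_ratio mulr_gt0// invr_gt0 exprn_gt0//.
Qed.

(** The breakdown estimate concerns [0 < r], while the supremum also includes the limiting value at
    the center. *)
Lemma mean_mass_le (R : realType) (n : nat) (a : R -> complex R) (M : R) :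
  0 <= M -> (forall r, 0 < r -> mass_ratio n a r <= M) ->
  forall r, 0 <= r -> mean_mass n a r <= M.
Proof.
move=> M0 HM r; rewrite le_eqVlt => /predU1P[<-|r0]; last first.
  by rewrite /mean_mass gt_eqF//; exact: HM.
rewrite /mean_mass eqxx.
(* A divergent [lim] is the default point of [R], which is [0]. *)
have [cv|/dvgP->//] := pselect (cvg (mass_ratio n a r @[r --> 0^'+])).
apply: limr_le => //; near=> x; apply: HM; near: x; exact: nbhs_right_gt.
Unshelve. all: by end_near. Qed.

(** * From the mass estimate to the breakdown time *)

Theorem theorem1p5 (R : realType) (n : nat) (lambda : R)
    (a0 : R -> complex R)
    (hlambda : lambda < 0) (hn : (4 <= n)%N)
    (ha0 : C1_amplitude a0)
    (ha0_neq0 : exists2 r : R, 0 <= r & a0 r != 0) :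
  (max_existence_time n lambda a0 <= breakdown_time n lambda a0)%E /\
  (breakdown_time n lambda a0 < +oo)%E.
Proof.
rewrite /breakdown_time.
set c : R := ((n - 2) * (n - 3))%:R.
set S := ereal_sup _.
have c0 : 0 < c.
  by rewrite /c ltr0n muln_gt0 !subn_gt0 (leq_trans _ hn)// (leq_trans _ hn).
have k0 : 0 < `|lambda| by rewrite normr_gt0 lt_eqF.
have n2 : (0 < n - 2)%N by rewrite subn_gt0 (leq_trans _ hn).
have n2R : 0 < (n - 2)%:R :> R by rewrite ltr0n.
have [r1 r10 m1] := mean_mass_gt0 n ha0 ha0_neq0.
have S0 : (0 < S)%E.
  apply: (@lt_le_trans _ _ (mean_mass n a0 r1)%:E); first by rewrite lte_fin.
  by apply: ereal_sup_ubound; exists r1.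
(* Positivity of [S] excludes division by zero; if [S] is infinite the quotient is 0. *)
have fin : (c%:E / (`|lambda|%:E * S) < +oo)%E.
  move: S0; case: S => [s|_|//].
    rewrite lte_fin => s0; rewrite -EFinM inver gt_eqF ?mulr_gt0//.
    by rewrite -EFinM ltry.
  by rewrite gt0_muley ?lte_fin// invey mule0.
have bfin : (((c%:E / (`|lambda|%:E * S)) `^ (n - 2)%:R^-1) < +oo)%E.
  exact: poweR_lty.
split=> //.
have bge := poweR_ge0 (c%:E / (`|lambda|%:E * S))%E (n - 2)%:R^-1.
apply: ub_ereal_sup => _ [T [T0 [rho [v sol]]] <-].
have key (T1 : R) : 0 < T1 -> T1 < T ->
    (T1%:E <= (c%:E / (`|lambda|%:E * S)) `^ (n - 2)%:R^-1)%E.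
  move=> T10 T1T.
  have T1n : 0 < T1 ^+ (n - 2) by rewrite exprn_gt0.
  have kT : 0 < `|lambda| * T1 ^+ (n - 2) by rewrite mulr_gt0.
  have SM : (S <= (c / (`|lambda| * T1 ^+ (n - 2)))%:E)%E.
    apply: ub_ereal_sup => _ [r r0 <-]; rewrite lee_fin.
    apply: mean_mass_le => //; first by rewrite divr_ge0// ltW.
    move=> x x0; rewrite ler_pdivlMr// mulrC.
    exact: EP_solution_mass_ratio sol _ _ _.
  (* A solution living past some [T1 > 0] makes [S] finite by [SM], so only the real case
     remains. *)
  move: S0 SM {fin bfin bge}; case: S => [s|//|//]; rewrite lte_fin lee_fin => s0.
  rewrite ler_pdivlMr// => sM.
  have ks : 0 < `|lambda| * s by rewrite mulr_gt0.
  rewrite -EFinM inver gt_eqF// -EFinM poweR_EFin lee_fin.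
  have <- : (T1 ^+ (n - 2)) `^ (n - 2)%:R^-1 = T1.
    by rewrite -powR_mulrn ?(ltW T10)// -powRrM mulfV ?gt_eqF// powRr1// ltW.
  apply: ge0_ler_powR; rewrite ?nnegrE ?invr_ge0 ?(ltW n2R) ?(ltW T1n)//.
    by rewrite divr_ge0// ltW.
  by rewrite ler_pdivlMr//; apply: le_trans sM; rewrite le_eqVlt; apply/orP; left;
    apply/eqP; ring.
move: bge bfin key; case: (_ `^ _)%E => [b|//|//]; rewrite !lee_fin => b0 _ key.
(* [key] covers only times strictly before [T]; if [b < T], the midpoint of [b] and [T] contradicts
   it. *)
rewrite leNgt; apply/negP => bT.
have := key ((b + T) / 2); rewrite lee_fin; lra.
Qed.
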